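(* Let $(H,[-,-,-])$ be an Abelian heap. The set $E(H)$ of all heap endomorphisms of $(H,[-,-,-])$ is a truss with the pointwise heap operation, for all $\alpha,\beta,\gamma\in E(H)$, $$[\alpha,\beta,\gamma]:H\to H,\qquad x\mapsto[\alpha(x),\beta(x),\gamma(x)],$$ and the composition $\circ$ of functions as the binary operation.
   Context: A heap is a non-empty set $H$ with a ternary operation $[-,-,-]$ satisfying $[v,w,[x,y,z]]=[[v,w,x],y,z]$ and $[x,x,y]=y=[y,x,x]$; it is Abelian if $[x,y,z]=[z,y,x]$. A heap endomorphism is a function $\varphi:H\to H$ with $\varphi([x,y,z])=[\varphi(x),\varphi(y),\varphi(z)]$. A truss is an Abelian heap $T$ with an associative binary operation (juxtaposition) satisfying $w[x,y,z]=[wx,wy,wz]$ and $[x,y,z]w=[xw,yw,zw]$ for all $w,x,y,z\in T$. *)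

(* Defs.v *)
From mathcomp Require Import all_boot.

Set Implicit Arguments.
Unset Strict Implicit.
Unset Printing Implicit Defensive.

Record is_heap (H : Type) (br : H -> H -> H -> H) : Prop := IsHeap {
  heap_inhabited : inhabited H;
  heap_assoc : forall v w x y z, br v w (br x y z) = br (br v w x) y z;
  heap_malcev_l : forall x y, br x x y = y;
  heap_malcev_r : forall x y, br y x x = y
}.

Record is_abelian_heap (H : Type) (br : H -> H -> H -> H) : Prop :=
  IsAbelianHeap {
    abelian_heap_heap : is_heap br;
    abelian_heap_sym : forall x y z, br x y z = br z y x
  }.

Record is_truss (T : Type) (br : T -> T -> T -> T) (mul : T -> T -> T) : Prop :=
  IsTruss {
    truss_abelian_heap : is_abelian_heap br;
    truss_mulA : associative mul;
    truss_mul_brr : forall w x y z,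
      mul w (br x y z) = br (mul w x) (mul w y) (mul w z);
    truss_mul_brl : forall w x y z,
      mul (br x y z) w = br (mul x w) (mul y w) (mul z w)
  }.

Definition is_heap_endo (H : Type) (br : H -> H -> H -> H) (phi : H -> H) :
    Prop :=
  forall x y z, phi (br x y z) = br (phi x) (phi y) (phi z).

(* The set E(H).  Equality of elements is equality of the underlying maps, by
   proof irrelevance. *)
Record heap_endo (H : Type) (br : H -> H -> H -> H) : Type := HeapEndo {
  heap_endo_fun :> H -> H;
  heap_endoP : is_heap_endo br heap_endo_fun
}.

Definition pointwise_br (H : Type) (br : H -> H -> H -> H)
    (alpha beta gamma : H -> H) : H -> H :=
  fun x => br (alpha x) (beta x) (gamma x).

(* Main.v *)
(** Composition distributes over the pointwise bracket for formal reasons.  The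
    point is that the bracket of an Abelian heap is itself a heap morphism
    [H^3 -> H]: flattening nested brackets by associativity gives an alternating
    word, in which the entries at odd positions and the entries at even positions
    may be permuted freely. *)

Require Import Defs.
From mathcomp Require Import all_boot.
From Stdlib Require Import FunctionalExtensionality ProofIrrelevance.

(** Reading [br x y z] as [x y^-1 z], the inverse of [b c^-1 d] reverses the word. *)
Lemma heap_br_mid (H : Type) (br : H -> H -> H -> H) (heapH : is_heap br)
    (a b c d e : H) :
  br a (br b c d) e = br (br a d c) b e.
Proof.
have [_ brA brl brr] := heapH.
(* Expanding [e] this way puts a second [br b c d] next to the middle one, and the two cancel. *)
have {1}<- : br (br b c d) d (br c b e) = e by rewrite -brA brl brA brr brl.
by rewrite brA brr brA.
Qed.

(** By [heap_br_mid], [b] and [d] are the outer entries of the middle bracket in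
    [br a (br d c b) e], so symmetry exchanges them. *)
Lemma abelian_heap_swap_neg (H : Type) (br : H -> H -> H -> H)
    (abH : is_abelian_heap br) (a b c d e : H) :
  br (br a b c) d e = br (br a d c) b e.
Proof.
have [heapH brC] := abH.
by rewrite -(heap_br_mid _ _ heapH) brC (brC d) brC (heap_br_mid _ _ heapH).
Qed.

Lemma abelian_heap_swap_pos (H : Type) (br : H -> H -> H -> H)
    (abH : is_abelian_heap br) (a b c d e : H) :
  br (br a b c) d e = br (br a b e) d c.
Proof.
have [[_ brA _ _] brC] := abH.
by rewrite -brA (brC c) brA.
Qed.

Lemma abelian_heap_interchange (H : Type) (br : H -> H -> H -> H)
    (abH : is_abelian_heap br) (a b c d e f g h i : H) :
  br (br a b c) (br d e f) (br g h i) = br (br a d g) (br b e h) (br c f i).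
Proof.
have [heapH _] := abH; have [_ brA _ _] := heapH.
have swapN := abelian_heap_swap_neg _ _ abH.
have swap x n p m q : br (br x n p) m q = br (br x m q) n p.
  by rewrite swapN (abelian_heap_swap_pos _ _ abH).
(* The sides flatten to the words [a b c f e d g h i] and [a d g h e b c f i]; the swaps carry the
   first to the second. *)
rewrite !(heap_br_mid _ _ heapH) !brA (swap _ f e d g) (swap a b c d g).
by rewrite (swapN _ f e h i) (swap _ b c h e).
Qed.

Lemma heap_endo_ext (H : Type) (br : H -> H -> H -> H)
    (alpha beta : heap_endo br) :
  alpha =1 beta -> alpha = beta.
Proof.
case: alpha beta => [f fP] [g gP] /= /functional_extensionality eq_fg.
by subst g; rewrite (proof_irrelevance _ fP gP).
Qed.

Theorem proposition3p38 (H : Type) (br : H -> H -> H -> H)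
    (abH : is_abelian_heap br) :
  exists (br_closed : forall alpha beta gamma : heap_endo br,
            is_heap_endo br (pointwise_br br alpha beta gamma))
         (comp_closed : forall alpha beta : heap_endo br,
            is_heap_endo br (alpha \o beta)),
    is_truss
      (fun alpha beta gamma : heap_endo br =>
         HeapEndo (br_closed alpha beta gamma))
      (fun alpha beta : heap_endo br => HeapEndo (comp_closed alpha beta)).
Proof.
have [[_ brA brl brr] brC] := abH.
have br_closed (alpha beta gamma : heap_endo br) :
    is_heap_endo br (pointwise_br br alpha beta gamma).
  move=> x y z; rewrite /pointwise_br !heap_endoP.
  exact: abelian_heap_interchange.
have comp_closed (alpha beta : heap_endo br) : is_heap_endo br (alpha \o beta).
  by move=> x y z; rewrite /= !heap_endoP.
(* The identity witnesses that E(H) is non-empty. *)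
have idP : is_heap_endo br id by [].
exists br_closed, comp_closed; split.
- split; first split.
  + exact: inhabits (HeapEndo idP).
  + by move=> *; apply: heap_endo_ext => t; apply: brA.
  + by move=> *; apply: heap_endo_ext => t; apply: brl.
  + by move=> *; apply: heap_endo_ext => t; apply: brr.
  + by move=> *; apply: heap_endo_ext => t; apply: brC.
- by move=> *; apply: heap_endo_ext.
(* Here the outer map [w] is applied to a bracket, so it must preserve brackets; associativity and
   the other distributive law hold by computation. *)
- by move=> w *; apply: heap_endo_ext => t; apply: (heap_endoP w).
- by move=> *; apply: heap_endo_ext.
Qed.
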